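(* Let $N$ be a positive integer, and let $\hat{\mathbf Q},\mathbf Q\in\mathbb R^N$ be non-constant vectors. Let $(k_1^*,k_2^* )$ be the minimizer over $(k_1,k_2)\in\mathbb R^2$ of $\sum_{i=1}^N(k_1\hat Q_i+k_2-Q_i)^2$, i.e. $$k_1^*=\frac{\sum_{i=1}^N(\hat Q_i-\hat a)(Q_i-a)}{\sum_{i=1}^N(\hat Q_i-\hat a)^2},\qquad k_2^*=a-k_1^*\hat a.$$ Let $l'$ be the variant of the Norm-in-Norm loss with $p=2$ and $q=2$, and let $b$ be the centered norm of $\mathbf Q$, both as defined in the context. Then $$\mathrm{RMSE}(k_1^*\hat{\mathbf Q}+k_2^*,\mathbf Q)=\sqrt{4b^2\,l'(\hat{\mathbf Q},\mathbf Q)/N}.$$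
   Context: For parameters $p,q\ge1$ and $\hat{\mathbf Q}=(\hat Q_1,\dots,\hat Q_N)$, $\mathbf Q=(Q_1,\dots,Q_N)$ in $\mathbb R^N$, set $$\hat a=\frac1N\sum_{i=1}^N\hat Q_i,\quad \hat b=\Big(\sum_{i=1}^N|\hat Q_i-\hat a|^q\Big)^{1/q},\quad a=\frac1N\sum_{i=1}^N Q_i,\quad b=\Big(\sum_{i=1}^N|Q_i-a|^q\Big)^{1/q},$$ $$\hat S_i=\frac{\hat Q_i-\hat a}{\hat b},\qquad S_i=\frac{Q_i-a}{b}\qquad(i=1,\dots,N),$$ with $\hat{\mathbf S}=(\hat S_1,\dots,\hat S_N)$ and $\mathbf S=(S_1,\dots,S_N)$. For non-constant $\mathbf x,\mathbf y\in\mathbb R^N$ with means $\bar x,\bar y$, Pearson's linear correlation coefficient is $$\rho(\mathbf x,\mathbf y)=\frac{\sum_{i=1}^N(x_i-\bar x)(y_i-\bar y)}{\sqrt{\sum_{i=1}^N(x_i-\bar x)^2\sum_{i=1}^N(y_i-\bar y)^2}}.$$ The variant of the Norm-in-Norm loss is $$l'(\hat{\mathbf Q},\mathbf Q)=\frac1c\sum_{i=1}^N|\rho(\hat{\mathbf S},\mathbf S)\hat S_i-S_i|^p,\qquad c=\begin{cases}2^pN^{1-p/q}& p<q,\\ 2^p& p\ge q.\end{cases}$$ The expression $k_1\hat{\mathbf Q}+k_2$ denotes the vector with entries $k_1\hat Q_i+k_2$, and $\mathrm{RMSE}(\mathbf x,\mathbf y)=\sqrt{\frac1N\sum_{i=1}^N(x_i-y_i)^2}$.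 *)

(* Defs.v *)
From mathcomp Require Import all_boot all_order all_algebra.
From mathcomp Require Import all_classical all_reals all_analysis.

Set Implicit Arguments.
Unset Strict Implicit.
Unset Printing Implicit Defensive.

Import Order.TTheory GRing.Theory Num.Theory.

Local Open Scope ring_scope.

(* Vectors of R^N are row vectors 'rV[R]_N; the exponents p, q are reals and
   [`^] is the real power [powR], with 0 `^ r = 0 for r != 0. *)

Definition nonconstant (R : realType) (N : nat) (x : 'rV[R]_N) : Prop :=
  exists i j : 'I_N, x ord0 i != x ord0 j.

Definition mean (R : realType) (N : nat) (x : 'rV[R]_N) : R :=
  N%:R^-1 * \sum_(i < N) x ord0 i.

(* The l^q norm of x - mean x: b and \hat b in the text. *)
Definition centered_norm (R : realType) (q : R) (N : nat) (x : 'rV[R]_N) : R :=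
  (\sum_(i < N) `|x ord0 i - mean x| `^ q) `^ q^-1.

Definition normalize (R : realType) (q : R) (N : nat) (x : 'rV[R]_N)
    : 'rV[R]_N :=
  \row_(i < N) ((x ord0 i - mean x) / centered_norm q x).

Definition pearson (R : realType) (N : nat) (x y : 'rV[R]_N) : R :=
  (\sum_(i < N) (x ord0 i - mean x) * (y ord0 i - mean y)) /
  Num.sqrt ((\sum_(i < N) (x ord0 i - mean x) ^+ 2) *
            (\sum_(i < N) (y ord0 i - mean y) ^+ 2)).

Definition nin_const (R : realType) (p q : R) (N : nat) : R :=
  if p < q then 2 `^ p * N%:R `^ (1 - p / q) else 2 `^ p.

(* The variant l' of the Norm-in-Norm loss; the prediction Qh comes first. *)
Definition nin_loss' (R : realType) (p q : R) (N : nat) (Qh Q : 'rV[R]_N) : R :=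
  let Sh := normalize q Qh in
  let S := normalize q Q in
  (nin_const p q N)^-1 *
  \sum_(i < N) `|pearson Sh S * Sh ord0 i - S ord0 i| `^ p.

Definition rmse (R : realType) (N : nat) (x y : 'rV[R]_N) : R :=
  Num.sqrt (N%:R^-1 * \sum_(i < N) (x ord0 i - y ord0 i) ^+ 2).

Definition lsq_error (R : realType) (N : nat) (Qh Q : 'rV[R]_N) (k1 k2 : R) : R :=
  \sum_(i < N) (k1 * Qh ord0 i + k2 - Q ord0 i) ^+ 2.

Definition lsq_minimizer (R : realType) (N : nat) (Qh Q : 'rV[R]_N)
    (k1 k2 : R) : Prop :=
  forall l1 l2 : R, lsq_error Qh Q k1 k2 <= lsq_error Qh Q l1 l2.

Definition lsq_slope (R : realType) (N : nat) (Qh Q : 'rV[R]_N) : R :=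
  (\sum_(i < N) (Qh ord0 i - mean Qh) * (Q ord0 i - mean Q)) /
  (\sum_(i < N) (Qh ord0 i - mean Qh) ^+ 2).

Definition lsq_intercept (R : realType) (N : nat) (Qh Q : 'rV[R]_N) : R :=
  mean Q - lsq_slope Qh Q * mean Qh.

(* Main.v *)
Require Import Defs.
From mathcomp Require Import all_boot all_order all_algebra.
From mathcomp Require Import all_classical all_reals all_analysis.
From mathcomp Require Import ring.

Set Implicit Arguments.
Unset Strict Implicit.
Unset Printing Implicit Defensive.

Import Order.TTheory GRing.Theory Num.Theory.

Local Open Scope ring_scope.

(** Splitting each residual into its mean and its centered part,
    [lsq_error k1 k2 = V(Qh) (k1 - slope)^2 + N (k1 mean Qh + k2 - mean Q)^2 + const],
    which identifies the unique minimizer. For [q = 2] the normalized vectors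
    are centered of Euclidean norm 1, so their correlation is
    [<Qh - mean, Q - mean> / (bh b)] and [rho Sh_i - S_i] is [1 / b] times the
    residual of the least-squares fit at [i]. *)

Definition dev (R : realType) (N : nat) (x : 'rV[R]_N) (i : 'I_N) : R :=
  x ord0 i - mean x.

(** This is [N] times the covariance of [x] and [y]; on the diagonal, [N] times the variance. *)
Definition dev_dot (R : realType) (N : nat) (x y : 'rV[R]_N) : R :=
  \sum_(i < N) dev x i * dev y i.

Lemma dev_dotxx (R : realType) (N : nat) (x : 'rV[R]_N) :
  dev_dot x x = \sum_(i < N) (x ord0 i - mean x) ^+ 2.
Proof. by apply: eq_bigr => i _; rewrite expr2. Qed.

Lemma dev_dot_ge0 (R : realType) (N : nat) (x : 'rV[R]_N) : 0 <= dev_dot x x.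
Proof. by rewrite dev_dotxx sumr_ge0// => i _; rewrite sqr_ge0. Qed.

(** If the sum of squares vanished, every entry would equal the mean. This makes the denominator of
    the slope and the centered norms nonzero. *)
Lemma dev_dot_gt0 (R : realType) (N : nat) (x : 'rV[R]_N) :
  nonconstant x -> 0 < dev_dot x x.
Proof.
move=> [i [j nij]]; rewrite lt_def dev_dot_ge0 andbT; apply: contra nij.
rewrite dev_dotxx psumr_eq0 => [/allP dev0|k _]; last exact: sqr_ge0.
have eq_mean k : x ord0 k = mean x.
  by have := dev0 k (mem_index_enum k); rewrite /= sqrf_eq0 subr_eq0 => /eqP.
by rewrite !eq_mean.
Qed.

Lemma sum_dev (R : realType) (N : nat) (x : 'rV[R]_N) :
  (0 < N)%N -> \sum_(i < N) dev x i = 0.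
Proof.
move=> N_gt0; rewrite sumrB sumr_const card_ord -mulr_natl /mean mulrA.
by rewrite mulfV ?mul1r ?subrr// pnatr_eq0 -lt0n.
Qed.

Lemma lsq_error_split (R : realType) (N : nat) (Qh Q : 'rV[R]_N) (k1 k2 : R) :
  (0 < N)%N -> nonconstant Qh ->
  lsq_error Qh Q k1 k2 =
    dev_dot Qh Qh * (k1 - lsq_slope Qh Q) ^+ 2
    + N%:R * (k1 * mean Qh + k2 - mean Q) ^+ 2
    + (dev_dot Q Q - dev_dot Qh Q ^+ 2 / dev_dot Qh Qh).
Proof.
move=> N_gt0 /dev_dot_gt0/lt0r_neq0 A_neq0.
have slopeE : lsq_slope Qh Q = dev_dot Qh Q / dev_dot Qh Qh.
  by rewrite dev_dotxx.
(* The mean of the residuals: the [i]-th one is [k1 * dev Qh i - dev Q i + e]. The cross terms with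
   [e] are linear in the deviations, so [sum_dev] kills them. *)
pose e := k1 * mean Qh + k2 - mean Q.
have -> : lsq_error Qh Q k1 k2 =
    k1 ^+ 2 * dev_dot Qh Qh - 2 * k1 * dev_dot Qh Q + dev_dot Q Q
    + N%:R * e ^+ 2 + 2 * e * k1 * (\sum_(i < N) dev Qh i)
    - 2 * e * (\sum_(i < N) dev Q i).
  have -> : N%:R * e ^+ 2 = \sum_(i < N) e ^+ 2.
    by rewrite sumr_const card_ord mulr_natl.
  rewrite /dev_dot !mulr_sumr -!sumrN -!big_split /=.
  by apply: eq_bigr => i _; rewrite /dev /e; ring.
(* What remains is completing the square in [k1]. *)
rewrite !sum_dev// slopeE /e; field.
exact: A_neq0.
Qed.

Lemma lsq_minimizerP (R : realType) (N : nat) (Qh Q : 'rV[R]_N) (k1 k2 : R) :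
  (0 < N)%N -> nonconstant Qh ->
  lsq_minimizer Qh Q k1 k2 <->
  k1 = lsq_slope Qh Q /\ k2 = lsq_intercept Qh Q.
Proof.
move=> N_gt0 ncQh; have A_gt0 := dev_dot_gt0 ncQh.
have N_gt0R : 0 < N%:R :> R by rewrite ltr0n.
have intercept0 : lsq_slope Qh Q * mean Qh + lsq_intercept Qh Q - mean Q = 0.
  by rewrite /lsq_intercept; ring.
split=> [/(_ (lsq_slope Qh Q) (lsq_intercept Qh Q))|[-> ->] l1 l2].
  (* At the candidate pair both squares vanish, so minimality bounds the two nonnegative terms at
     [(k1, k2)] by 0 and forces each to be 0. *)
  rewrite !lsq_error_split// lerD2r intercept0 subrr expr0n !mulr0 addr0 => le0.
  have sq1 : 0 <= dev_dot Qh Qh * (k1 - lsq_slope Qh Q) ^+ 2.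
    by rewrite mulr_ge0 ?sqr_ge0// ltW.
  have sq2 : 0 <= N%:R * (k1 * mean Qh + k2 - mean Q) ^+ 2.
    by rewrite mulr_ge0 ?sqr_ge0// ltW.
  have : dev_dot Qh Qh * (k1 - lsq_slope Qh Q) ^+ 2
         + N%:R * (k1 * mean Qh + k2 - mean Q) ^+ 2 == 0.
    by rewrite eq_le le0 addr_ge0.
  rewrite paddr_eq0// !mulf_eq0 !(gt_eqF A_gt0, gt_eqF N_gt0R) !orbb /=.
  rewrite !subr_eq0 => /andP[/eqP -> /eqP meanQ]; split=> //.
  by rewrite /lsq_intercept -meanQ addrAC subrr add0r.
rewrite !lsq_error_split// lerD2r intercept0 subrr expr0n !mulr0 addr0.
by rewrite addr_ge0// mulr_ge0 ?sqr_ge0// ltW.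
Qed.

Lemma centered_norm2 (R : realType) (N : nat) (x : 'rV[R]_N) :
  centered_norm 2 x = Num.sqrt (dev_dot x x).
Proof.
rewrite dev_dotxx -powR12_sqrt -?dev_dotxx ?dev_dot_ge0// dev_dotxx.
congr (_ `^ _); apply: eq_bigr => i _.
by rewrite powR_mulrn ?normr_ge0// real_normK// num_real.
Qed.

Lemma mean_normalize (R : realType) (q : R) (N : nat) (x : 'rV[R]_N) :
  (0 < N)%N -> mean (normalize q x) = 0.
Proof.
move=> N_gt0; rewrite /mean (eq_bigr (fun i => dev x i / centered_norm q x)).
  by rewrite -mulr_suml sum_dev// mul0r mulr0.
by move=> i _; rewrite mxE.
Qed.

(** Normalized vectors have mean 0, so centering them again changes nothing. *)
Lemma dev_normalize (R : realType) (q : R) (N : nat) (x : 'rV[R]_N) (i : 'I_N) :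
  (0 < N)%N -> dev (normalize q x) i = dev x i / centered_norm q x.
Proof.
move=> N_gt0; rewrite {1}/dev (mean_normalize _ _ N_gt0).
rewrite (subr0 (normalize q x _ _)).
exact: mxE.
Qed.

Lemma dev_dot_normalize (R : realType) (q : R) (N : nat) (x y : 'rV[R]_N) :
  (0 < N)%N ->
  dev_dot (normalize q x) (normalize q y) =
    dev_dot x y / (centered_norm q x * centered_norm q y).
Proof.
move=> N_gt0; rewrite /dev_dot mulr_suml; apply: eq_bigr => i _.
(* A term proof: rewriting would compare [normalize q x] with [normalize q y]
   by unfolding [powR], which does not terminate in practice. *)
exact: etrans (congr2 *%R (dev_normalize q x i N_gt0)
  (dev_normalize q y i N_gt0)) (mulf_div _ _ _ _).
Qed.

Lemma pearson_unit (R : realType) (N : nat) (x y : 'rV[R]_N) :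
  dev_dot x x = 1 -> dev_dot y y = 1 -> pearson x y = dev_dot x y.
Proof.
move=> xx1 yy1; rewrite /pearson -!dev_dotxx xx1 yy1 mulr1 sqrtr1.
exact: divr1.
Qed.

Lemma dev_dot_normalize2xx (R : realType) (N : nat) (x : 'rV[R]_N) :
  (0 < N)%N -> nonconstant x -> dev_dot (normalize 2 x) (normalize 2 x) = 1.
Proof.
move=> N_gt0 /dev_dot_gt0 x_gt0; rewrite (dev_dot_normalize 2 x x N_gt0).
rewrite centered_norm2 -expr2 (sqr_sqrtr (ltW x_gt0)).
exact: divff (lt0r_neq0 x_gt0).
Qed.

Lemma pearson_normalize2 (R : realType) (N : nat) (x y : 'rV[R]_N) :
  (0 < N)%N -> nonconstant x -> nonconstant y ->
  pearson (normalize 2 x) (normalize 2 y) =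
    dev_dot x y / (centered_norm 2 x * centered_norm 2 y).
Proof.
move=> N_gt0 ncx ncy; apply: etrans (dev_dot_normalize 2 x y N_gt0).
by apply: pearson_unit; exact: dev_dot_normalize2xx.
Qed.

Lemma nin_loss'22 (R : realType) (N : nat) (Qh Q : 'rV[R]_N) :
  (0 < N)%N -> nonconstant Qh -> nonconstant Q ->
  4 * centered_norm 2 Q ^+ 2 * nin_loss' 2 2 Qh Q =
    lsq_error Qh Q (lsq_slope Qh Q) (lsq_intercept Qh Q).
Proof.
move=> N_gt0 ncQh ncQ.
(* The case [p = q] falls in the second branch, with value [2 ^ 2]. *)
have constE : nin_const 2 2 N = 4 :> R.
  by rewrite /nin_const ltxx powR_mulrn// expr2 -natrM.
have bh_neq0 : centered_norm 2 Qh != 0.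
  by rewrite centered_norm2 gt_eqF// sqrtr_gt0 dev_dot_gt0.
have b_neq0 : centered_norm 2 Q != 0.
  by rewrite centered_norm2 gt_eqF// sqrtr_gt0 dev_dot_gt0.
have slopeE : lsq_slope Qh Q = dev_dot Qh Q / centered_norm 2 Qh ^+ 2.
  by rewrite centered_norm2 sqr_sqrtr ?dev_dot_ge0// dev_dotxx.
(* The termwise identity over plain reals, where [field] applies: [c / bh ^+ 2] stands for the slope
   and [m - c / bh ^+ 2 * mh] for the intercept. *)
have residual_scaling (c bh b xh mh x m rho sh s : R) :
    bh != 0 -> b != 0 -> rho = c / (bh * b) ->
    sh = (xh - mh) / bh -> s = (x - m) / b ->
    b ^+ 2 * (rho * sh - s) ^+ 2 =
    (c / bh ^+ 2 * xh + (m - c / bh ^+ 2 * mh) - x) ^+ 2.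
  by move=> bh0 b0 -> -> ->; field; rewrite bh0.
have cancel4 u v : 4 * u * (4^-1 * v) = u * v :> R by field.
rewrite /nin_loss' constE cancel4 mulr_sumr.
apply: eq_bigr => i _.
rewrite powR_mulrn ?normr_ge0// real_normK ?num_real//.
rewrite /lsq_intercept slopeE.
exact: (residual_scaling _ _ _ _ _ _ _ _ _ _ bh_neq0 b_neq0
  (pearson_normalize2 N_gt0 ncQh ncQ) (mxE _ _ _ _) (mxE _ _ _ _)).
Qed.

Theorem mainTheorem4 (R : realType) (N : nat) (hN : (0 < N)%N)
    (Qh Q : 'rV[R]_N) (hQh : nonconstant Qh) (hQ : nonconstant Q) :
  (forall k1 k2 : R, lsq_minimizer Qh Q k1 k2 <->
     k1 = lsq_slope Qh Q /\ k2 = lsq_intercept Qh Q) /\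
  rmse (lsq_slope Qh Q *: Qh + const_mx (lsq_intercept Qh Q)) Q =
    Num.sqrt (4 * centered_norm 2 Q ^+ 2 * nin_loss' 2 2 Qh Q / N%:R).
Proof.
split=> [k1 k2|]; first exact: lsq_minimizerP.
(* Both radicands are now the least-squares error of the fitted pair divided by [N]. *)
rewrite nin_loss'22// /rmse mulrC /lsq_error; congr (Num.sqrt (_ / _)).
by apply: eq_bigr => i _; rewrite !mxE.
Qed.
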